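(* Let $T>0$, let $u_0:\mathbb{R}\to\mathbb{R}$ be Lipschitz continuous, and let $u_1,u_2:\mathbb{R}\times(0,T]\to\mathbb{R}$ be two smooth solutions of the equation $$u_t=\frac{u_{xx}}{1+u_x^2}$$ with the same initial data $u_0$, that is, $\lim_{t\to 0}u_1(\cdot,t)=\lim_{t\to 0}u_2(\cdot,t)=u_0$. Then $u_1=u_2$ on $\mathbb{R}\times(0,T]$.
   Context: The limits $\lim_{t\to0}u_i(\cdot,t)=u_0$ are understood as uniform convergence on compact subsets of $\mathbb{R}$. No growth condition at spatial infinity is imposed on $u_0$ (beyond the stated regularity) or on $u_1,u_2$. *)

(* Defs.v *)
From Stdlib Require Import Reals.
From Coquelicot Require Import Coquelicot.
Open Scope R_scope.

(* Functions on R x (0,T] are represented by total functions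
   [u : R -> R -> R], [u x t]; values for [t] outside (0,T] are never used. *)

Definition continuous_strip (T : R) (u : R -> R -> R) : Prop :=
  forall x t : R, 0 < t <= T ->
    filterlim (fun p : R * R => u (fst p) (snd p))
      (within (fun p : R * R => 0 < snd p <= T) (locally (x, t)))
      (locally (u x t)).

(* Derivative relative to (0,T]: two-sided for t < T, left-sided at t = T. *)
Definition is_derive_t (T : R) (u : R -> R -> R) (x t l : R) : Prop :=
  filterdiff (fun s : R => u x s)
    (within (fun s : R => 0 < s <= T) (locally t))
    (fun h : R => scal h l).

Definition is_derive_x (u : R -> R -> R) (x t l : R) : Prop :=
  is_derive (fun y : R => u y t) x l.

Fixpoint Ck_strip (k : nat) (T : R) (u : R -> R -> R) : Prop :=
  continuous_strip T u /\
  match k with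
  | O => True
  | S k' =>
      exists ux ut : R -> R -> R,
        (forall x t : R, 0 < t <= T ->
           is_derive_x u x t (ux x t) /\ is_derive_t T u x t (ut x t)) /\
        Ck_strip k' T ux /\ Ck_strip k' T ut
  end.

Definition smooth_strip (T : R) (u : R -> R -> R) : Prop :=
  forall k : nat, Ck_strip k T u.

Definition smooth_solution (T : R) (u : R -> R -> R) : Prop :=
  smooth_strip T u /\
  forall x t : R, 0 < t <= T ->
    is_derive_t T u x t
      (Derive_n (fun y : R => u y t) 2 x
       / (1 + Derive (fun y : R => u y t) x ^ 2)).

Definition lipschitz (f : R -> R) : Prop :=
  exists L : R, forall x y : R, Rabs (f x - f y) <= L * Rabs (x - y).

(* Uniform convergence on compact sets as t -> 0+. *)
Definition initial_data (u : R -> R -> R) (u0 : R -> R) : Prop :=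
  forall K : R -> Prop, compact K ->
  forall eps : R, 0 < eps ->
    at_right 0 (fun t : R => forall x : R, K x -> Rabs (u x t - u0 x) < eps).

(* Main.v *)
Require Import Defs.
From Stdlib Require Import Reals Lra.
From Coquelicot Require Import Coquelicot.
Open Scope R_scope.

(** The equation is a conservation law, [u_t = (arctan u_x)_x], whose flux is
    bounded by [PI / 2] and increasing in [u_x].  The difference [w] of two
    solutions therefore satisfies [w_t = F_x], where
    [F = arctan (u1_x) - arctan (u2_x)] obeys [|F| <= PI] and [w_x F >= 0].
    Let [psi x = 1 - (x / r)^2] on [[-r, r]] and let [E] be the integral of
    [psi^2 w^2] over this interval.  Integrating by parts,
    [E' = - 2 int psi^2 w_x F - 4 int psi psi' w F
        <= E + 4 PI^2 int psi'^2 <= E + 32 PI^2 / r]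
    (lemma [dissipation_estimate]).  Uniform convergence to the common initial
    datum gives [E -> 0] as [t -> 0], so that Gronwall's lemma yields
    [E t <= e^t t 32 PI^2 / r] (lemma [energy_bound]).  The right-hand side
    tends to [0] as [r] grows, whereas [E] eventually dominates a quarter of
    the integral of [w^2] over any fixed interval; hence [w = 0].

    The bound on the flux is what replaces a control of [w] at infinity: the
    cutoff error [4 psi psi' w F] is at most [psi^2 w^2 + 4 psi'^2 F^2], whose
    second term is small for large [r] whatever the size of [w]. *)

(** * Interior regularity and the divergence form of the equation *)

Lemma locally_within_strip (T t : R) (P : R -> Prop) :
  0 < t < T ->
  locally t P <-> within (fun s => 0 < s <= T) (locally t) P.
Proof.
  intros Ht; split.
  - intros [d Hd]; exists d; intros y Hy _; exact (Hd y Hy).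
  - intros [d Hd].
    assert (Hp : 0 < Rmin d (Rmin t (T - t))).
    { repeat apply Rmin_pos; try lra; apply cond_pos. }
    exists (mkposreal _ Hp); intros y Hy.
    change (Rabs (y - t) < Rmin d (Rmin t (T - t))) in Hy.
    pose proof (Rmin_l d (Rmin t (T - t))).
    pose proof (Rmin_r d (Rmin t (T - t))).
    pose proof (Rmin_l t (T - t)). pose proof (Rmin_r t (T - t)).
    pose proof (Rabs_def2 _ _ Hy).
    apply Hd; [change (Rabs (y - t) < d)|]; lra.
Qed.

Lemma is_derive_t_interior (T : R) (u : R -> R -> R) (x t l : R) :
  0 < t < T -> is_derive_t T u x t l -> is_derive (fun s => u x s) t l.
Proof.
  intros Ht [_ H]; split.
  { apply is_linear_scal_l. }
  intros y Hy eps.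
  assert (Hlim : is_filter_lim (within (fun s => 0 < s <= T) (locally t)) y).
  { intros P HP; exact (proj1 (locally_within_strip T t _ Ht) (Hy P HP)). }
  exact (proj2 (locally_within_strip T t _ Ht) (H y Hlim eps)).
Qed.

(** Time becomes the first argument, as it is the parameter when the energy is
    differentiated under the integral sign. *)
Lemma continuous_strip_interior (T : R) (u : R -> R -> R) (x t : R) :
  0 < t < T -> continuous_strip T u ->
  continuity_2d_pt (fun s y => u y s) t x.
Proof.
  intros Ht H eps.
  assert (Ht' : 0 < t <= T) by lra.
  pose proof (proj1 (filterlim_locally _ _) (H x t Ht') eps) as [d Hd].
  assert (Hp : 0 < Rmin d (Rmin t (T - t))).
  { repeat apply Rmin_pos; try lra; apply cond_pos. }
  exists (mkposreal _ Hp); simpl; intros s y Hs Hy.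
  pose proof (Rmin_l d (Rmin t (T - t))).
  pose proof (Rmin_r d (Rmin t (T - t))).
  pose proof (Rmin_l t (T - t)). pose proof (Rmin_r t (T - t)).
  pose proof (Rabs_def2 _ _ Hs).
  apply (Hd (y, s)).
  - split; [change (Rabs (y - x) < d)|change (Rabs (s - t) < d)]; lra.
  - simpl; lra.
Qed.

Lemma continuity_2d_pt_section (f : R -> R -> R) (t x : R) :
  continuity_2d_pt f t x -> continuous (f t) x.
Proof.
  intros H; apply filterlim_locally; intros eps.
  destruct (H eps) as [d Hd]; exists d; intros y Hy.
  apply (Hd t y); [rewrite Rminus_diag, Rabs_R0; apply cond_pos | exact Hy].
Qed.

(** Conservation-law form of the equation on the open strip: [atan ux] is the
    flux. *)
Record flux_solution (T : R) (u ux ut : R -> R -> R) : Prop := {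
  flux_dx : forall x t, 0 < t < T -> is_derive (fun y => u y t) x (ux x t);
  flux_dt : forall x t, 0 < t < T -> is_derive (fun s => u x s) t (ut x t);
  flux_law : forall x t, 0 < t < T ->
    is_derive (fun y => atan (ux y t)) x (ut x t);
  flux_cont : forall x t, 0 < t < T ->
    continuity_2d_pt (fun s y => u y s) t x;
  flux_cont_dx : forall x t, 0 < t < T -> continuous (fun y => ux y t) x;
  flux_cont_dt : forall x t, 0 < t < T ->
    continuity_2d_pt (fun s y => ut y s) t x
}.

Lemma smooth_solution_flux (T : R) (u : R -> R -> R) :
  smooth_solution T u -> exists ux ut, flux_solution T u ux ut.
Proof.
  intros [Hs Heq].
  destruct (Hs 2%nat) as [Hc [ux [ut [Hd [[Hcx [uxx [uxt [Hdx _]]]] [Hct _]]]]]].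
  exists ux, ut.
  assert (Hx : forall x t, 0 < t < T ->
    is_derive (fun y => u y t) x (ux x t)).
  { intros x t Ht; apply Hd; lra. }
  assert (Ht : forall x t, 0 < t < T ->
    is_derive (fun s => u x s) t (ut x t)).
  { intros x t Ht; apply (is_derive_t_interior T); [exact Ht|].
    apply Hd; lra. }
  split; auto.
  - intros x t H.
    assert (Hxx : is_derive (fun y => ux y t) x (uxx x t)) by (apply Hdx; lra).
    assert (E : ut x t = uxx x t / (1 + ux x t ^ 2)).
    { rewrite <- (is_derive_unique _ _ _ (Ht x t H)).
      apply is_derive_unique, (is_derive_t_interior T); [exact H|].
      assert (H' : 0 < t <= T) by lra.
      replace (uxx x t) with (Derive_n (fun y => u y t) 2 x).
      2:{ simpl; rewrite <- (is_derive_unique _ _ _ Hxx).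
          apply Derive_ext; intros y; apply is_derive_unique, Hx, H. }
      replace (ux x t) with (Derive (fun y => u y t) x).
      2:{ apply is_derive_unique, Hx, H. }
      apply Heq; lra. }
    rewrite E.
    evar_last.
    + apply (is_derive_comp atan (fun y => ux y t));
        [apply is_derive_atan | exact Hxx].
    + unfold scal, Rdiv, Rsqr; simpl; unfold mult; simpl.
      now rewrite Rmult_1_r.
  - intros x t H; apply continuous_strip_interior with T; auto.
  - intros x t H.
    apply (continuity_2d_pt_section (fun s y => ux y s)).
    apply continuous_strip_interior with T; auto.
  - intros x t H; apply continuous_strip_interior with T; auto.
Qed.

(** * The dissipation estimate at a fixed time *)

Lemma pow2_div_le_1 (r x : R) :
  0 < r -> - r <= x <= r -> x ^ 2 / r ^ 2 <= 1.
Proof.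
  intros Hr Hx; apply Rle_div_l; [apply pow_lt, Hr|].
  assert (0 <= (r - x) * (r + x)) by (apply Rmult_le_pos; lra).
  lra.
Qed.

Definition bump (r x : R) : R := 1 - (x / r) ^ 2.

Lemma continuous_bump (r x : R) : continuous (bump r) x.
Proof. apply (ex_derive_continuous (bump r)); unfold bump; auto_derive; auto. Qed.

Ltac solve_continuous :=
  match goal with
  | |- continuous (fun _ => ?c) _ => apply continuous_const
  | |- continuous (fun x => @?f x + @?g x) _ =>
      apply (continuous_plus f g); solve_continuous
  | |- continuous (fun x => @?f x - @?g x) _ =>
      apply (continuous_minus f g); solve_continuous
  | |- continuous (fun x => @?f x * @?g x) _ =>
      apply (continuous_mult f g); solve_continuous
  | _ => solve [auto using continuous_bump]
  end.

Lemma monotone_flux (a b : R) : 0 <= (a - b) * (atan a - atan b).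
Proof.
  destruct (Rtotal_order a b) as [H|[H|H]].
  - pose proof (atan_increasing _ _ H); nra.
  - subst; lra.
  - pose proof (atan_increasing _ _ H); nra.
Qed.

Lemma flux_difference_bound (a b : R) : (atan a - atan b) ^ 2 <= PI ^ 2.
Proof.
  pose proof (atan_bound a); pose proof (atan_bound b); nra.
Qed.

(** Pointwise content of the estimate: with [s = psi], [d = psi'], [F] the
    flux difference and [v = w_x], the left-hand side exceeds the derivative
    of [2 psi^2 w F] by at most the Young remainder of [4 psi psi' w F]. *)
Lemma young_flux (s d w v F dF : R) :
  0 <= v * F -> F ^ 2 <= PI ^ 2 ->
  s ^ 2 * (2 * w * dF) <=
    (2 * (s ^ 2 * (v * F + w * dF) + 2 * s * d * w * F))
    + (s ^ 2 * w ^ 2 + 4 * PI ^ 2 * d ^ 2).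
Proof.
  intros HvF HF.
  assert (0 <= s ^ 2 * (v * F)) by (apply Rmult_le_pos; [apply pow2_ge_0|lra]).
  assert (0 <= d ^ 2 * (PI ^ 2 - F ^ 2))
    by (apply Rmult_le_pos; [apply pow2_ge_0|lra]).
  pose proof (pow2_ge_0 (s * w + 2 * d * F)).
  lra.
Qed.

(** The boundary terms of the integration by parts vanish with [bump r], which
    turns the pointwise inequality [young_flux] into a bound of the time
    derivative of the energy; [dF] plays the part of [w_t].  The remainder
    [4 PI^2 psi'^2] is at most [16 PI^2 / r^2] on an interval of length
    [2 r]. *)
Lemma dissipation_estimate (r : R) (w a b dF : R -> R) :
  0 < r ->
  (forall x, is_derive w x (a x - b x)) ->
  (forall x, is_derive (fun y => atan (a y) - atan (b y)) x (dF x)) ->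
  (forall x, continuous a x) -> (forall x, continuous b x) ->
  (forall x, continuous dF x) ->
  RInt (fun x => bump r x ^ 2 * (2 * w x * dF x)) (- r) r <=
  RInt (fun x => bump r x ^ 2 * w x ^ 2) (- r) r + 32 * PI ^ 2 / r.
Proof.
  intros Hr Hw HF Ha Hb HdF.
  set (F := fun y => atan (a y) - atan (b y)) in *.
  set (d := fun x => - 2 * x / r ^ 2).
  set (dG := fun x => 2 * (bump r x ^ 2 * ((a x - b x) * F x + w x * dF x)
                           + 2 * bump r x * d x * w x * F x)).
  assert (cw : forall x, continuous w x).
  { intros x; apply (ex_derive_continuous w); eexists; apply Hw. }
  assert (cF : forall x, continuous F x).
  { intros x; apply (ex_derive_continuous F); eexists; apply HF. }
  assert (cs : forall x, continuous (bump r) x) by (apply continuous_bump).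
  assert (cd : forall x, continuous d x).
  { intros x; apply (ex_derive_continuous d); unfold d; auto_derive; nra. }
  assert (cdG : forall x, continuous dG x).
  { intros x; unfold dG; simpl.
    solve_continuous. }
  assert (cE : forall x, continuous (fun x => bump r x ^ 2 * w x ^ 2) x).
  { intros x; simpl.
    solve_continuous. }
  assert (cL : forall x,
    continuous (fun x => bump r x ^ 2 * (2 * w x * dF x)) x).
  { intros x; simpl.
    solve_continuous. }
  assert (IG : is_RInt dG (- r) r 0).
  { evar_last.
    - apply (is_RInt_derive (fun x => 2 * (bump r x ^ 2 * (w x * F x)))).
      + intros x _; unfold dG.
        evar_last.
        * apply is_derive_scal, @is_derive_mult.
          -- unfold bump; auto_derive; [auto|reflexivity].
          -- apply @is_derive_mult; [apply Hw|apply HF|apply Rmult_comm].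
          -- apply Rmult_comm.
        * unfold d, bump, plus, mult; simpl; field; lra.
      + intros x _; apply cdG.
    - unfold bump, minus, plus, opp; simpl; field; lra. }
  set (c := 16 * PI ^ 2 / r ^ 2).
  replace (32 * PI ^ 2 / r) with ((r - - r) * c) by (unfold c; field; lra).
  assert (IE : ex_RInt (fun x => bump r x ^ 2 * w x ^ 2) (- r) r)
    by (apply @ex_RInt_continuous; auto).
  pose proof (is_RInt_plus _ _ _ _ _ _ IG
    (is_RInt_plus _ _ _ _ _ _ (RInt_correct _ _ _ IE)
       (is_RInt_const (- r) r c))) as I.
  assert (EI : RInt (fun x => bump r x ^ 2 * w x ^ 2) (- r) r + (r - - r) * c
    = RInt (fun x => plus (dG x) (plus (bump r x ^ 2 * w x ^ 2) c)) (- r) r).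
  { etransitivity; [|symmetry; exact (is_RInt_unique _ _ _ _ I)].
    unfold plus, scal; simpl; unfold mult; simpl; ring. }
  rewrite EI.
  apply RInt_le.
  - lra.
  - apply @ex_RInt_continuous; auto.
  - eexists; exact I.
  - intros x Hx; unfold plus; simpl.
    eapply Rle_trans.
    + apply (young_flux (bump r x) (d x) (w x) (a x - b x) (F x) (dF x)).
      * apply monotone_flux.
      * apply flux_difference_bound.
    + apply Rplus_le_compat_l, Rplus_le_compat_l.
      unfold c, d.
      replace (16 * PI ^ 2 / r ^ 2) with (4 * PI ^ 2 * (4 / r ^ 2))
        by (field; lra).
      apply Rmult_le_compat_l; [pose proof (pow2_ge_0 PI); lra|].
      replace ((- 2 * x / r ^ 2) ^ 2) with (4 / r ^ 2 * (x ^ 2 / r ^ 2))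
        by (field; lra).
      rewrite <- (Rmult_1_r (4 / r ^ 2)) at 2.
      apply Rmult_le_compat_l.
      * apply Rlt_le, Rdiv_lt_0_compat; [lra|apply pow_lt; lra].
      * apply pow2_div_le_1; lra.
Qed.

(** * Evolution of the localised energy *)

Definition energy (r : R) (w : R -> R -> R) (t : R) : R :=
  RInt (fun x => bump r x ^ 2 * w x t ^ 2) (- r) r.

Lemma is_derive_energy (r T : R) (w wt : R -> R -> R) (t : R) :
  0 < t < T ->
  (forall x s, 0 < s < T -> is_derive (fun s => w x s) s (wt x s)) ->
  (forall x s, 0 < s < T -> continuity_2d_pt (fun s y => w y s) s x) ->
  (forall x s, 0 < s < T -> continuity_2d_pt (fun s y => wt y s) s x) ->
  is_derive (energy r w) t
    (RInt (fun x => bump r x ^ 2 * (2 * w x t * wt x t)) (- r) r).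
Proof.
  intros Ht Hw cw cwt.
  assert (HD : forall x s, 0 < s < T ->
    is_derive (fun s => bump r x ^ 2 * w x s ^ 2) s
      (bump r x ^ 2 * (2 * w x s * wt x s))).
  { intros x s Hs. apply is_derive_scal.
    evar_last.
    - apply is_derive_pow, Hw, Hs.
    - simpl; ring. }
  assert (Hloc : locally t (fun s => 0 < s < T)).
  { apply (proj2 (locally_within_strip T t _ Ht)).
    assert (Hp : 0 < T - t) by lra.
    exists (mkposreal _ Hp); intros s Hs H.
    change (Rabs (s - t) < T - t) in Hs; apply Rabs_def2 in Hs; lra. }
  rewrite (RInt_ext _
    (fun x => Derive (fun s => bump r x ^ 2 * w x s ^ 2) t)).
  2:{ intros x _; symmetry; apply is_derive_unique, HD, Ht. }
  apply (is_derive_RInt_param (fun s x => bump r x ^ 2 * w x s ^ 2)).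
  - eapply filter_imp; [|exact Hloc]; intros s Hs x _.
    eexists; apply HD, Hs.
  - intros x _.
    apply continuity_2d_pt_ext_loc with
      (fun s y => bump r y ^ 2 * (2 * w y s * wt y s)).
    + destruct Hloc as [e He]; exists e; intros s y Hs _.
      symmetry; apply is_derive_unique, HD, He, Hs.
    + assert (cb : continuity_2d_pt (fun _ y => bump r y) t x).
      { apply (continuity_1d_2d_pt_comp (bump r) (fun _ y => y)).
        - apply continuity_pt_filterlim, continuous_bump.
        - apply continuity_2d_pt_id2. }
      apply continuity_2d_pt_mult; [|repeat apply continuity_2d_pt_mult].
      * simpl; apply continuity_2d_pt_mult; [exact cb|].
        apply continuity_2d_pt_mult; [exact cb|apply continuity_2d_pt_const].
      * apply continuity_2d_pt_const.
      * apply cw, Ht.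
      * apply cwt, Ht.
  - eapply filter_imp; [|exact Hloc]; intros s Hs.
    apply @ex_RInt_continuous; intros x _; simpl.
    pose proof (continuity_2d_pt_section _ _ _ (cw x s Hs)) as c.
    pose proof (continuous_bump r x) as cb.
    solve_continuous.
Qed.

Lemma nonincreasing_of_derivative (T : R) (f df : R -> R) (s t : R) :
  (forall x, 0 < x < T -> is_derive f x (df x)) ->
  (forall x, 0 < x < T -> df x <= 0) ->
  0 < s -> s <= t -> t < T -> f t <= f s.
Proof.
  intros Hd Hn Hs Hst Ht.
  destruct (MVT_gen f s t df) as [c [Hc E]];
    rewrite ?(Rmin_left s t Hst), ?(Rmax_right s t Hst) in *.
  - intros x Hx; apply Hd; lra.
  - intros x Hx; apply continuity_pt_filterlim.
    apply (ex_derive_continuous f); eexists; apply Hd; lra.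
  - assert (Hc' : 0 < c < T) by lra. pose proof (Hn c Hc'); nra.
Qed.

(** Since [f] carries no information at [0] itself, its initial value is
    expressed by smallness to the right of [0]; the function
    [exp (- t) f t - C t] is nonincreasing on the open interval. *)
Lemma gronwall_vanishing (T C : R) (f df : R -> R) :
  0 <= C ->
  (forall t, 0 < t < T -> is_derive f t (df t)) ->
  (forall t, 0 < t < T -> df t <= f t + C) ->
  (forall eps, 0 < eps -> at_right 0 (fun t => f t <= eps)) ->
  forall t, 0 < t < T -> f t <= exp t * (C * t).
Proof.
  intros HC Hd Hdf H0 t Ht.
  set (g := fun s => exp (- s) * f s - C * s).
  assert (Hg : forall s, 0 < s <= t -> g t <= g s).
  { intros s Hs.
    apply (nonincreasing_of_derivative T g
      (fun s => exp (- s) * (df s - f s) - C)); try lra.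
    - intros x Hx; unfold g.
      evar_last.
      + apply @is_derive_minus.
        * apply @is_derive_mult;
            [auto_derive; [auto|reflexivity] | apply Hd, Hx | apply Rmult_comm].
        * auto_derive; [auto|reflexivity].
      + unfold minus, plus, opp, mult; simpl; ring.
    - intros x Hx.
      pose proof (Hdf x Hx); pose proof (exp_pos (- x)).
      assert (exp (- x) <= 1).
      { rewrite <- exp_0; apply Rlt_le, exp_increasing; lra. }
      assert (exp (- x) * (df x - f x) <= exp (- x) * C)
        by (apply Rmult_le_compat_l; lra).
      nra. }
  assert (Hgt : g t <= 0).
  { apply Rnot_lt_le; intros Hpos.
    assert (He : 0 < g t / 2) by lra.
    destruct (H0 _ He) as [d Hd0].
    pose proof (cond_pos d) as Hdp.
    set (s := Rmin (d / 2) t).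
    assert (Hs : 0 < s) by (apply Rmin_pos; lra).
    pose proof (Rmin_l (d / 2) t : s <= d / 2).
    assert (Hst : s <= t) by apply Rmin_r.
    assert (Hfs : f s <= g t / 2).
    { apply Hd0; [|exact Hs].
      change (Rabs (s - 0) < d); rewrite Rminus_0_r, Rabs_right; lra. }
    pose proof (Hg s (conj Hs Hst)) as Hgs.
    pose proof (exp_pos (- s)).
    assert (exp (- s) <= 1).
    { rewrite <- exp_0; apply Rlt_le, exp_increasing; lra. }
    unfold g in Hgs at 2.
    assert (exp (- s) * f s <= exp (- s) * (g t / 2))
      by (apply Rmult_le_compat_l; lra).
    nra. }
  unfold g in Hgt.
  assert (E : f t = exp t * (exp (- t) * f t)).
  { rewrite <- Rmult_assoc, <- exp_plus, Rplus_opp_r, exp_0; ring. }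
  rewrite E; apply Rmult_le_compat_l; [apply Rlt_le, exp_pos | lra].
Qed.

Lemma energy_initial (r T : R) (w : R -> R -> R) :
  0 < r -> 0 < T ->
  (forall x t, 0 < t < T -> continuous (fun y => w y t) x) ->
  (forall eps, 0 < eps ->
    at_right 0 (fun t => forall x, - r <= x <= r -> Rabs (w x t) < eps)) ->
  forall eps, 0 < eps -> at_right 0 (fun t => energy r w t <= eps).
Proof.
  intros Hr HT cw H0 eps He.
  assert (Hq : 0 < eps / (2 * r)) by (apply Rdiv_lt_0_compat; lra).
  assert (HTr : at_right 0 (fun t => 0 < t < T)).
  { exists (mkposreal T HT); intros t Ht Hpos.
    change (Rabs (t - 0) < T) in Ht; apply Rabs_def2 in Ht; lra. }
  eapply filter_imp; [|exact (filter_and _ _ HTr (H0 _ (sqrt_lt_R0 _ Hq)))].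
  intros t [Ht Hw]; unfold energy.
  replace eps with (RInt (fun _ => eps / (2 * r)) (- r) r).
  2:{ rewrite RInt_const; unfold scal; simpl; unfold mult; simpl; field; lra. }
  apply RInt_le.
  - lra.
  - apply @ex_RInt_continuous; intros x _; simpl.
    pose proof (cw x t Ht) as c.
    pose proof (continuous_bump r x) as cb.
    solve_continuous.
  - apply ex_RInt_const.
  - intros x Hx.
    assert (Hx' : - r <= x <= r) by lra.
    pose proof (Hw x Hx') as Hs.
    assert (Hb : 0 <= bump r x <= 1).
    { unfold bump.
      assert (0 <= (x / r) ^ 2 <= 1).
      { replace ((x / r) ^ 2) with (x ^ 2 / r ^ 2) by (field; lra).
        split; [|apply pow2_div_le_1; lra].
        apply Rdiv_le_0_compat; [apply pow2_ge_0|apply pow_lt; lra]. }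
      lra. }
    assert (w x t ^ 2 <= eps / (2 * r)).
    { rewrite <- (pow2_sqrt (eps / (2 * r))), <- (pow2_abs (w x t)) by lra.
      apply pow_incr; split; [apply Rabs_pos|lra]. }
    assert (bump r x ^ 2 <= 1) by nra.
    pose proof (pow2_ge_0 (w x t)). nra.
Qed.

Lemma energy_bound (T r : R) (u1 u1x u1t u2 u2x u2t : R -> R -> R) :
  0 < r ->
  flux_solution T u1 u1x u1t -> flux_solution T u2 u2x u2t ->
  (forall eps, 0 < eps ->
    at_right 0 (fun t => forall x, - r <= x <= r ->
      Rabs (u1 x t - u2 x t) < eps)) ->
  forall t, 0 < t < T ->
    energy r (fun x t => u1 x t - u2 x t) t
      <= exp t * (32 * PI ^ 2 / r * t).
Proof.
  intros Hr S1 S2 H0 t Ht.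
  set (w := fun x t => u1 x t - u2 x t).
  assert (cw : forall x s, 0 < s < T ->
    continuity_2d_pt (fun s y => w y s) s x).
  { intros x s Hs; apply continuity_2d_pt_minus;
      [apply (flux_cont _ _ _ _ S1)|apply (flux_cont _ _ _ _ S2)]; exact Hs. }
  assert (cwt : forall x s, 0 < s < T ->
    continuity_2d_pt (fun s y => u1t y s - u2t y s) s x).
  { intros x s Hs; apply continuity_2d_pt_minus;
      [apply (flux_cont_dt _ _ _ _ S1)|apply (flux_cont_dt _ _ _ _ S2)];
      exact Hs. }
  apply (gronwall_vanishing T (32 * PI ^ 2 / r) (energy r w)
    (fun t => RInt (fun x => bump r x ^ 2
       * (2 * w x t * (u1t x t - u2t x t))) (- r) r)); auto.
  - apply Rdiv_le_0_compat; [pose proof (pow2_ge_0 PI); lra|exact Hr].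
  - intros s Hs.
    apply (is_derive_energy r T w (fun x t => u1t x t - u2t x t)); auto.
    intros x s' Hs'; apply @is_derive_minus;
      [apply (flux_dt _ _ _ _ S1)|apply (flux_dt _ _ _ _ S2)]; exact Hs'.
  - intros s Hs.
    apply (dissipation_estimate r (fun x => w x s) (fun x => u1x x s)
      (fun x => u2x x s) (fun x => u1t x s - u2t x s)); auto; intros x.
    + apply @is_derive_minus;
        [apply (flux_dx _ _ _ _ S1)|apply (flux_dx _ _ _ _ S2)]; exact Hs.
    + apply @is_derive_minus;
        [apply (flux_law _ _ _ _ S1)|apply (flux_law _ _ _ _ S2)]; exact Hs.
    + apply (flux_cont_dx _ _ _ _ S1), Hs.
    + apply (flux_cont_dx _ _ _ _ S2), Hs.
    + apply (continuity_2d_pt_section (fun s y => u1t y s - u2t y s)), cwt, Hs.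
  - apply (energy_initial r T); auto; [lra|].
    intros x s Hs; apply (continuity_2d_pt_section (fun s y => w y s)), cw, Hs.
Qed.

(** * Letting the cutoff radius tend to infinity *)

(** On the inner half of its interval the cutoff is at least
    [1 - 1 / 4 >= 1 / 2], which gives the factor [1 / 4]. *)
Lemma energy_lower_bound (r a b t : R) (w : R -> R -> R) :
  0 < r -> a <= b -> - r / 2 <= a -> b <= r / 2 ->
  (forall x, continuous (fun y => w y t) x) ->
  / 4 * RInt (fun x => w x t ^ 2) a b <= energy r w t.
Proof.
  intros Hr Hab Ha Hb cw; unfold energy.
  set (f := fun x => bump r x ^ 2 * w x t ^ 2).
  assert (cw2 : forall x, continuous (fun x => w x t ^ 2) x).
  { intros x; simpl.
    solve_continuous. }
  assert (cf : forall x, continuous f x).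
  { intros x; unfold f; simpl; solve_continuous. }
  assert (If : forall c d, ex_RInt f c d)
    by (intros; apply @ex_RInt_continuous; auto).
  assert (Pf : forall x, 0 <= f x).
  { intros x; apply Rmult_le_pos; apply pow2_ge_0. }
  rewrite <- (RInt_Chasles f (- r) a r), <- (RInt_Chasles f a b r) by auto.
  assert (H1 : 0 <= RInt f (- r) a) by (apply RInt_ge_0; auto; lra).
  assert (H2 : 0 <= RInt f b r) by (apply RInt_ge_0; auto; lra).
  assert (H3 : / 4 * RInt (fun x => w x t ^ 2) a b <= RInt f a b).
  { assert (Iw : ex_RInt (fun x => w x t ^ 2) a b)
      by (apply @ex_RInt_continuous; auto).
    change (scal (/ 4) (RInt (fun x => w x t ^ 2) a b) <= RInt f a b).
    rewrite <- RInt_scal by exact Iw.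
    apply RInt_le; auto.
    - apply @ex_RInt_scal, Iw.
    - intros x Hx; unfold scal, f; simpl; unfold mult; simpl.
      apply Rmult_le_compat_r; [apply (pow2_ge_0 (w x t))|].
      assert (/ 2 <= bump r x).
      { unfold bump.
        assert (- / 2 <= x / r) by (apply Rle_div_r; lra).
        assert (x / r <= / 2) by (apply Rle_div_l; lra).
        nra. }
      nra. }
  unfold plus; cbn -[RInt pow]; lra.
Qed.

Lemma zero_of_energy_decay (w : R -> R -> R) (t K : R) :
  (forall x, continuous (fun y => w y t) x) ->
  (forall r, 0 < r -> energy r w t <= K / r) ->
  forall x, w x t = 0.
Proof.
  intros cw HE x.
  destruct (Req_dec (w x t) 0) as [E|NE]; [exact E|exfalso].
  assert (Hp : 0 < Rabs (w x t)) by (apply Rabs_pos_lt, NE).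
  destruct (proj1 (filterlim_locally _ _) (cw x) (mkposreal _ Hp)) as [d Hd].
  pose proof (cond_pos d) as Hdp.
  set (J := RInt (fun y => w y t ^ 2) (x - d / 2) (x + d / 2)).
  assert (HJ : 0 < J).
  { apply RInt_gt_0; [lra| |].
    - intros y Hy.
      assert (Hb : Rabs (w y t - w x t) < Rabs (w x t)).
      { apply (Hd y); change (Rabs (y - x) < d); apply Rabs_def1; lra. }
      assert (w y t <> 0).
      { intros E; rewrite E, Rminus_0_l, Rabs_Ropp in Hb; lra. }
      assert (0 < Rsqr (w y t)) by (apply Rlt_0_sqr; auto).
      unfold Rsqr in *; simpl; lra.
    - intros y _; simpl.
      solve_continuous. }
  pose proof (Rabs_pos K); pose proof (Rabs_pos x).
  pose proof (Rle_abs K); pose proof (Rle_abs x); pose proof (Rle_abs (- x)).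
  rewrite Rabs_Ropp in *.
  (* The first two terms make the half interval contain the ball about x, the
     last one makes K / r smaller than J / 4. *)
  set (r := 2 * Rabs x + d + 4 * (Rabs K + 1) / J).
  assert (Hq : 0 < 4 * (Rabs K + 1) / J) by (apply Rdiv_lt_0_compat; lra).
  assert (Hr : 0 < r) by (unfold r; lra).
  assert (HL : / 4 * J <= energy r w t).
  { apply energy_lower_bound; auto; unfold r; lra. }
  pose proof (HE r Hr) as HU.
  assert (HK : / 4 * J <= K / r) by lra.
  apply Rle_div_r in HK; [|exact Hr].
  assert (HJr : 4 * (Rabs K + 1) <= r * J).
  { replace (4 * (Rabs K + 1)) with (4 * (Rabs K + 1) / J * J)
      by (field; lra).
    apply Rmult_le_compat_r; unfold r; lra. }
  lra.
Qed.

Lemma initial_data_difference (u1 u2 : R -> R -> R) (u0 : R -> R) (r : R) :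
  initial_data u1 u0 -> initial_data u2 u0 ->
  forall eps, 0 < eps ->
    at_right 0 (fun t => forall x, - r <= x <= r ->
      Rabs (u1 x t - u2 x t) < eps).
Proof.
  intros h1 h2 eps He.
  assert (He2 : 0 < eps / 2) by lra.
  pose proof (h1 _ (compact_P3 (- r) r) _ He2) as H1.
  pose proof (h2 _ (compact_P3 (- r) r) _ He2) as H2.
  eapply filter_imp; [|exact (filter_and _ _ H1 H2)].
  intros t [A B] x Hx.
  pose proof (Rabs_def2 _ _ (A x Hx)); pose proof (Rabs_def2 _ _ (B x Hx)).
  apply Rabs_def1; lra.
Qed.

(** The final time is reached by continuity, the equation being used on the
    open strip. *)
Lemma eq_at_final_time (T : R) (u1 u2 : R -> R -> R) (x : R) :
  0 < T -> continuous_strip T u1 -> continuous_strip T u2 ->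
  (forall t, 0 < t < T -> u1 x t = u2 x t) -> u1 x T = u2 x T.
Proof.
  intros HT c1 c2 H.
  destruct (Req_dec (u1 x T) (u2 x T)) as [E|NE]; [exact E|exfalso].
  assert (Hp : 0 < Rabs (u1 x T - u2 x T) / 2).
  { pose proof (Rabs_pos_lt (u1 x T - u2 x T)); lra. }
  assert (HT' : 0 < T <= T) by lra.
  destruct (proj1 (filterlim_locally _ _) (c1 x T HT') (mkposreal _ Hp))
    as [d1 H1].
  destruct (proj1 (filterlim_locally _ _) (c2 x T HT') (mkposreal _ Hp))
    as [d2 H2].
  pose proof (cond_pos d1); pose proof (cond_pos d2).
  set (m := Rmin (Rmin d1 d2) T).
  assert (Hm : 0 < m) by (repeat apply Rmin_pos; lra).
  pose proof (Rmin_l (Rmin d1 d2) T : m <= Rmin d1 d2).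
  pose proof (Rmin_r (Rmin d1 d2) T : m <= T).
  pose proof (Rmin_l d1 d2); pose proof (Rmin_r d1 d2).
  assert (Hb : forall d : posreal, m <= d -> ball (x, T) d (x, T - m / 2)).
  { intros d Hd; split; [apply ball_center|].
    change (Rabs (T - m / 2 - T) < d); apply Rabs_def1; lra. }
  assert (Hs : 0 < T - m / 2 < T) by lra.
  assert (Hs' : 0 < T - m / 2 <= T) by lra.
  assert (A : Rabs (u1 x (T - m / 2) - u1 x T) < Rabs (u1 x T - u2 x T) / 2).
  { apply (H1 (x, T - m / 2)); [apply Hb; lra|exact Hs']. }
  assert (B : Rabs (u2 x (T - m / 2) - u2 x T) < Rabs (u1 x T - u2 x T) / 2).
  { apply (H2 (x, T - m / 2)); [apply Hb; lra|exact Hs']. }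
  rewrite (H _ Hs) in A.
  pose proof (Rabs_def2 _ _ A); pose proof (Rabs_def2 _ _ B).
  revert A B; unfold Rabs at 2 4; destruct (Rcase_abs (u1 x T - u2 x T)) as [L|L];
    intros A B; apply Rabs_def2 in A; apply Rabs_def2 in B; lra.
Qed.

Theorem theorem1p1 (T : R) (u0 : R -> R) (u1 u2 : R -> R -> R)
  (hT : 0 < T)
  (hu0 : lipschitz u0)
  (hu1 : smooth_solution T u1)
  (hu2 : smooth_solution T u2)
  (hi1 : initial_data u1 u0)
  (hi2 : initial_data u2 u0) :
  forall x t : R, 0 < t <= T -> u1 x t = u2 x t.
Proof.
  destruct (smooth_solution_flux T u1 hu1) as [u1x [u1t S1]].
  destruct (smooth_solution_flux T u2 hu2) as [u2x [u2t S2]].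
  assert (Hopen : forall x t, 0 < t < T -> u1 x t = u2 x t).
  { intros x t Ht; apply Rminus_diag_uniq.
    apply (zero_of_energy_decay (fun x t => u1 x t - u2 x t) t
      (exp t * (32 * PI ^ 2 * t))).
    - intros y; apply (continuous_minus (fun y => u1 y t) (fun y => u2 y t));
        [ apply (continuity_2d_pt_section (fun s y => u1 y s)),
            (flux_cont _ _ _ _ S1), Ht
        | apply (continuity_2d_pt_section (fun s y => u2 y s)),
            (flux_cont _ _ _ _ S2), Ht ].
    - intros r Hr.
      replace (exp t * (32 * PI ^ 2 * t) / r)
        with (exp t * (32 * PI ^ 2 / r * t)) by (field; lra).
      apply (energy_bound T r u1 u1x u1t u2 u2x u2t); auto.
      apply (initial_data_difference u1 u2 u0); assumption. }
  intros x t [Ht0 HtT].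
  destruct (Rle_lt_or_eq_dec t T HtT) as [Hlt|E]; [apply Hopen; lra|].
  subst t; apply (eq_at_final_time T); auto.
  - exact (proj1 (proj1 hu1 0%nat)).
  - exact (proj1 (proj1 hu2 0%nat)).
Qed.
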